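(* Let $k$ be a field of characteristic zero, let $q\in k\setminus\{0\}$ not be a root of unity, and let $\phi\in\{\sigma_x,\tau_{x,q}\}$. Let $f\in k(x,y)$ and suppose $f=\phi(g)-g+D_y(h)+\sum_{i=1}^m a_i/d_i$ with $g,h\in k(x,y)$, where $a_i\in k(x)[y]$ are nonzero, $d_i\in k[x,y]$ are irreducible, $\deg_y(a_i)<\deg_y(d_i)$, and the $d_i$ lie in pairwise distinct $\phi$-orbits. Then $f$ is exact with respect to $(\phi-1,D_y)$ if and only if for each $i\in\{1,\dots,m\}$ we have $d_i\in k[y]$ and $a_i=\phi(b_i)-b_i$ for some $b_i\in k(x)[y]$.
   Context: On $k(x,y)$: $\sigma_x(f(x,y))=f(x+1,y)$, $\tau_{x,q}(f(x,y))=f(qx,y)$, $D_y=\partial/\partial y$. The $\phi$-orbit of a polynomial $p$ is $\{\phi^i(p):i\in\mathbb{Z}\}$. A rational function $f$ is exact with respect to $(\partial_x,\partial_y)$ if $f=\partial_x(g)+\partial_y(h)$ for some $g,h\in k(x,y)$. The decomposition in the hypothesis is called a $(\phi,D_y)$-reduced form of $f$.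
   Formalization: The d_i are required to lie in distinct φ-orbits up to nonzero constant factors of k (no φ^n(d_i) = c·d_j for i ≠ j); with literal orbits the claim fails, e.g. 1/(x+y) + (−2)/(2(x+y)) = 0. *)

(* Defs.v *)
From HB Require Import structures.
From mathcomp Require Import all_boot all_order all_algebra.
Set Implicit Arguments. Unset Strict Implicit. Unset Printing Implicit Defensive.
Import Order.TTheory GRing.Theory Num.Theory.
Local Open Scope ring_scope.
Local Open Scope quotient_scope.
Notation "x %:F" := (@FracField.tofrac _ x) : ring_scope.

(* Conventions:
   k[x]     = {poly F}                    (variable 'X is x)
   k(x)     = {fraction {poly F}}         (= kx F)
   k(x)[y]  = {poly (kx F)}               (variable 'X is y)
   k[x,y]   = {poly {poly F}}             (outer variable y, inner x)
   k(x,y)   = {fraction {poly (kx F)}}    (= kxy F, i.e. k(x)(y)) *)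

Definition kx (F : fieldType) := {fraction {poly F}}.
Definition kxy (F : fieldType) := {fraction {poly (kx F)}}.

Definition frac_lift (R : idomainType) (f : R -> R) (u : {fraction R})
  : {fraction R} :=
  let r := repr u in (f \n_r)%:F / (f \d_r)%:F.

Inductive shift_kind := Sigma | Tau.

Definition phi_pow_x (F : fieldType) (s : shift_kind) (q : F) (n : int)
    (p : {poly F}) : {poly F} :=
  match s with
  | Sigma => p \Po ('X + (n%:~R)%:P)
  | Tau => p \Po ((q ^ n) *: 'X)
  end.

Definition phi_x (F : fieldType) s (q : F) := phi_pow_x s q 1.
Definition phi_pow_xy (F : fieldType) s (q : F) (n : int) (d : {poly {poly F}})
  : {poly {poly F}} := map_poly (phi_pow_x s q n) d.
Definition phi_kx (F : fieldType) s (q : F) : kx F -> kx F :=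
  frac_lift (phi_x s q).
Definition phi_kxy_poly (F : fieldType) s (q : F) (a : {poly (kx F)})
  : {poly (kx F)} := map_poly (phi_kx s q) a.
Definition phi_kxy (F : fieldType) s (q : F) : kxy F -> kxy F :=
  frac_lift (phi_kxy_poly s q).

Definition Dy (F : fieldType) (u : kxy F) : kxy F :=
  let r := repr u in
  let n := \n_r in let d := \d_r in
  (n^`() * d - n * d^`())%:F / (d ^+ 2)%:F.

Definition kxy_of_poly (F : fieldType) (d : {poly {poly F}}) : {poly (kx F)} :=
  map_poly (fun c : {poly F} => c%:F) d.
Definition kxy_of_kxpoly (F : fieldType) (a : {poly (kx F)}) : kxy F := a%:F.

Definition exact_phi_Dy (F : fieldType) s (q : F) (f : kxy F) : Prop :=
  exists g h : kxy F, f = phi_kxy s q g - g + Dy h.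

Definition irreducible_elt (R : idomainType) (d : R) : Prop :=
  d != 0 /\ d \isn't a GRing.unit /\
  forall a b : R, d = a * b -> a \is a GRing.unit \/ b \is a GRing.unit.

Definition same_phi_orbit (F : fieldType) s (q : F) (d1 d2 : {poly {poly F}})
  : Prop :=
  exists (n : int) (c : F), c != 0 /\ phi_pow_xy s q n d1 = (c%:P)%:P * d2.

Definition in_ky (F : fieldType) (d : {poly {poly F}}) : Prop :=
  forall j : nat, (size ((d`_j)%R : {poly F}) <= 1)%N.

(* Main.v *)
(* Exactness is read off from the residues of [f] in [y].  Over [K = k(x)], an
   element of [K(y)] has zero residue at an irreducible [p] when it is a
   [y]-derivative plus a function regular at [p]; then [a / p] has zero residue
   only if [p] divides [a], and Hermite reduction brings every element to this
   form [a / p].  By Gauss's lemma the [d_i] stay irreducible in [K[y]] and are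
   associate there only if they differ by a constant of [k].  Write the fraction
   part as [r = phi G - G + D_y H].  If no nonzero power of [phi] fixes [d_i] up
   to a constant, comparing the residues of [G] along the infinite orbit of [d_i]
   forces the residue of [r] at [d_i] to vanish, against [a_i <> 0].  So [d_i] is
   semi-invariant under some power of [phi], hence free of [x], and comparing
   residues at [d_i] in [r = phi G - G + D_y H] gives [b_i]. *)
Require Import Defs.
From Stdlib Require Import Classical.
From HB Require Import structures.
From mathcomp Require Import all_boot all_order all_algebra.
From mathcomp Require Import ring zify.
Set Implicit Arguments. Unset Strict Implicit. Unset Printing Implicit Defensive.
Import GRing.Theory.
Local Open Scope ring_scope.
Local Open Scope quotient_scope.

(** * Morphisms and derivation on fraction fields *)

Section Fractions.
Variable R : idomainType.
Implicit Types (u v : {fraction R}) (a b : R).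

Lemma fracE u : u = (\n_(repr u))%:F / (\d_(repr u))%:F.
Proof.
have d0 := denom_ratioP (repr u).
apply: (mulIf (x := (\d_(repr u))%:F)); first by rewrite tofrac_eq0.
rewrite mulfVK ?tofrac_eq0 //.
rewrite -[X in X * _ = _](reprK u).
rewrite !piE; apply/eqP; rewrite piE /equivf /FracField.mulf /=.
rewrite !numden_Ratio ?oner_neq0 ?mulr1 //.
by rewrite mulrC.
Qed.

Lemma frac_ind (P : {fraction R} -> Prop) :
  (forall a b, b != 0 -> P (a%:F / b%:F)) -> forall u, P u.
Proof. by move=> H u; rewrite (fracE u); apply/H/denom_ratioP. Qed.

Lemma eq_frac a b a' b' : b != 0 -> b' != 0 ->
  (a%:F / b%:F == a'%:F / b'%:F) = (a * b' == a' * b).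
Proof.
by move=> b0 b'0; rewrite eqr_div ?tofrac_eq0 // -!tofracM tofrac_eq.
Qed.

Lemma sub_frac a b a' b' : b != 0 -> b' != 0 ->
  a%:F / b%:F - a'%:F / b'%:F = (a * b' - a' * b)%:F / (b * b')%:F.
Proof.
move=> b0 b'0; rewrite -mulNr addf_div ?tofrac_eq0 //.
by rewrite -tofracN -!tofracM -tofracD mulNr.
Qed.

Variable f : {rmorphism R -> R}.
Hypothesis f_inj : injective f.

(** [frac_lift] is computed on a chosen representative. [f] preserves the cross-multiplied equality
    of two representatives, and injectivity keeps the denominators nonzero. *)
Lemma frac_lift_div a b : b != 0 ->
  frac_lift f (a%:F / b%:F) = (f a)%:F / (f b)%:F.
Proof.
have fn0 c : c != 0 -> f c != 0.
  by move=> c0; rewrite -(rmorph0 f) (inj_eq f_inj).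
move=> b0; rewrite /frac_lift; set r := repr _.
have d0 : \d_r != 0 by apply: denom_ratioP.
have: a%:F / b%:F == (\n_r)%:F / (\d_r)%:F by rewrite -fracE.
rewrite eq_frac // => /eqP /(congr1 f); rewrite !rmorphM => E.
by apply/eqP; rewrite eq_frac ?fn0 // E.
Qed.

End Fractions.

(* [frac_lift] carries a ring morphism structure once injectivity of [f],
   kept here as an argument, is known. *)
Definition frac_map (R : idomainType) (f : {rmorphism R -> R})
  (f_inj : injective f) : {fraction R} -> {fraction R} := frac_lift f.

Section FracMap.
Variables (R : idomainType) (f : {rmorphism R -> R}) (f_inj : injective f).

Let f_neq0 c : c != 0 -> f c != 0.
Proof. by move=> c0; rewrite -(rmorph0 f) (inj_eq f_inj). Qed.

Lemma frac_map_div a b : b != 0 ->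
  frac_map f_inj (a%:F / b%:F) = (f a)%:F / (f b)%:F.
Proof. exact: frac_lift_div. Qed.

Lemma frac_map_tofrac a : frac_map f_inj a%:F = (f a)%:F.
Proof.
rewrite -[a%:F]divr1 -tofrac1 frac_map_div ?oner_neq0 //.
by rewrite rmorph1 tofrac1 divr1.
Qed.

Fact frac_map_is_zmod_morphism : zmod_morphism (frac_map f_inj).
Proof.
move=> u v; elim/frac_ind: u => a b b0; elim/frac_ind: v => a' b' b'0.
rewrite sub_frac // !frac_map_div ?mulf_neq0 // sub_frac ?f_neq0 //.
by rewrite !(rmorphB, rmorphM).
Qed.

Fact frac_map_is_monoid_morphism : monoid_morphism (frac_map f_inj).
Proof.
split=> [|u v]; first by rewrite -tofrac1 frac_map_tofrac rmorph1.
elim/frac_ind: u => a b b0; elim/frac_ind: v => a' b' b'0.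
rewrite mulf_div -!tofracM !frac_map_div ?mulf_neq0 // mulf_div.
by rewrite -!tofracM !rmorphM.
Qed.

HB.instance Definition _ :=
  GRing.isZmodMorphism.Build _ _ (frac_map f_inj) frac_map_is_zmod_morphism.
HB.instance Definition _ :=
  GRing.isMonoidMorphism.Build _ _ (frac_map f_inj) frac_map_is_monoid_morphism.

End FracMap.

(** Stated over an arbitrary field; over [kx F] it unfolds to [Dy]. *)
Definition frac_deriv (K : fieldType) (u : {fraction {poly K}}) :=
  let r := repr u in let n := \n_r in let d := \d_r in
  (n^`() * d - n * d^`())%:F / (d ^+ 2)%:F.

Section FracDeriv.
Variable K : fieldType.
Implicit Types (u v : {fraction {poly K}}) (a b : {poly K}).

Lemma frac_deriv_div a b : b != 0 ->
  frac_deriv (a%:F / b%:F) = (a^`() * b - a * b^`())%:F / (b ^+ 2)%:F.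
Proof.
move=> b0; rewrite /frac_deriv; set r := repr _.
have: \d_r != 0 by apply: denom_ratioP.
have: a%:F / b%:F == (\n_r)%:F / (\d_r)%:F by rewrite -fracE.
move: \n_r \d_r => n d E d0; move: E; rewrite eq_frac // => /eqP E.
have := congr1 (@deriv _) E; rewrite !derivM => E'.
apply/eqP; rewrite eq_frac ?expf_neq0 //; apply/eqP.
have -> : (n^`() * d - n * d^`()) * b ^+ 2 =
  (n^`() * b) * (d * b) - (n * b) * (d^`() * b) by ring.
(* [E'], the derivative of [E], eliminates the derivative of [n]. The remaining occurrences of [n]
   are in [n * b], which [E] turns into [a * d]. *)
have -> : n^`() * b = a^`() * d + a * d^`() - n * b^`() by rewrite E'; ring.
have -> : (a^`() * d + a * d^`() - n * b^`()) * (d * b) - n * b * (d^`() * b)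
  = a^`() * d * d * b + d^`() * b * (a * d)
    - b^`() * d * (n * b) - n * b * (d^`() * b) by ring.
by rewrite -E; ring.
Qed.

Fact frac_deriv_is_zmod_morphism : zmod_morphism (@frac_deriv K).
Proof.
move=> u v; elim/frac_ind: u => a b b0; elim/frac_ind: v => a' b' b'0.
rewrite sub_frac // !frac_deriv_div ?mulf_neq0 // sub_frac ?expf_neq0 //.
apply/eqP; rewrite eq_frac ?mulf_neq0 ?expf_neq0 ?mulf_neq0 //; apply/eqP.
by rewrite derivB !derivM; ring.
Qed.

HB.instance Definition _ := GRing.isZmodMorphism.Build _ _ (@frac_deriv K)
  frac_deriv_is_zmod_morphism.

Lemma frac_deriv_map (f : {rmorphism K -> K})
    (f_inj : injective (map_poly f)) u :
  frac_map f_inj (frac_deriv u) = frac_deriv (frac_map f_inj u).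
Proof.
elim/frac_ind: u => a b b0.
have fb0 : map_poly f b != 0 by rewrite map_poly_eq0.
rewrite frac_deriv_div // !frac_map_div ?expf_neq0 // frac_deriv_div //.
by rewrite !(rmorphB, rmorphXn, rmorphM) /= !deriv_map.
Qed.

End FracDeriv.

(** * Residues and Hermite reduction at an irreducible polynomial *)

(** For irreducible [p] this is the localization of [K[y]] at [p]. *)
Definition regular_at (K : fieldType) (p : {poly K}) (u : {fraction {poly K}}) :=
  exists n w : {poly K}, coprimep p w /\ u = n%:F / w%:F.

(* [u] has zero residue at the place [p]. *)
Definition deriv_mod_regular (K : fieldType) (p : {poly K})
    (u : {fraction {poly K}}) :=
  exists h v, regular_at p v /\ u = frac_deriv h + v.

Section Residue.
Variables (K : fieldType) (p : {poly K}).
Hypothesis charK0 : [pchar K] =i pred0.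
Hypothesis p_irr : irreducible_poly p.
Implicit Types (u v : {fraction {poly K}}) (a n w : {poly K}).

Let p0 : p != 0 := irredp_neq0 p_irr.

Let natr_eq0 (i : nat) : (i%:R == 0 :> K) = (i == 0%N).
Proof. by move/pcharf0P: charK0 => ->. Qed.

Let coprime_neq0 w : coprimep p w -> w != 0.
Proof.
by apply: contraTneq => ->; rewrite coprimep0 -size_poly_eq1 gtn_eqF // p_irr.1.
Qed.

Lemma regular_atB u v : regular_at p u -> regular_at p v -> regular_at p (u - v).
Proof.
move=> [n [w [cw ->]]] [n' [w' [cw' ->]]].
exists (n * w' - n' * w), (w * w'); rewrite coprimepMr cw cw'; split=> //.
by rewrite sub_frac ?coprime_neq0.
Qed.

Lemma regular_at0 : regular_at p 0.
Proof. by exists 0, 1; rewrite coprimep1 tofrac0 mul0r. Qed.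

Lemma regular_atD u v : regular_at p u -> regular_at p v -> regular_at p (u + v).
Proof.
move=> ru rv; rewrite -[v]opprK; apply: regular_atB => //.
by rewrite -sub0r; apply: regular_atB => //; apply: regular_at0.
Qed.

Lemma regular_deriv_mod u : regular_at p u -> deriv_mod_regular p u.
Proof. by exists 0, u; rewrite raddf0 add0r. Qed.

Lemma frac_deriv_mod u : deriv_mod_regular p (frac_deriv u).
Proof. by exists u, 0; rewrite addr0; split=> //; apply: regular_at0. Qed.

Lemma deriv_mod_regularB u v : deriv_mod_regular p u ->
  deriv_mod_regular p v -> deriv_mod_regular p (u - v).
Proof.
move=> [h [r [rr ->]]] [h' [r' [rr' ->]]].
exists (h - h'), (r - r'); split; first exact: regular_atB.
by rewrite raddfB opprD addrACA.
Qed.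

Lemma deriv_mod_regularD u v : deriv_mod_regular p u ->
  deriv_mod_regular p v -> deriv_mod_regular p (u + v).
Proof.
move=> [h [r [rr ->]]] [h' [r' [rr' ->]]].
exists (h + h'), (r + r'); split; first exact: regular_atD.
by rewrite raddfD addrACA.
Qed.

(** In characteristic zero the derivative is nonzero, and its degree is too small for [p] to divide
    it. *)
Lemma coprimep_deriv : coprimep p p^`().
Proof.
have p1 := p_irr.1.
have p'0 : p^`() != 0.
  apply/eqP => /(congr1 (fun r : {poly K} => r`_(size p).-2)).
  rewrite coef_deriv coef0 -mulr_natr => /eqP; rewrite mulf_eq0 natr_eq0.
  rewrite orbF prednK; last by rewrite -ltnS prednK // ltnW.
  by rewrite -lead_coefE lead_coef_eq0 (negPf p0).
rewrite irreducible_poly_coprime //; apply/negP => /(dvdp_leq p'0).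
by rewrite leqNgt lt_size_deriv.
Qed.

Lemma multiplicity_factor w0 : w0 != 0 ->
  exists e w, coprimep p w /\ w0 = p ^+ e * w.
Proof.
have [k] := ubnP (size w0); elim: k w0 => // k IHk w0 sw w00.
have [/dvdpP[w1 Ew]|ndvd] := boolP (p %| w0); last first.
  by exists 0%N, w0; rewrite mul1r irreducible_poly_coprime.
have w10 : w1 != 0 by apply: contraNneq w00 => E; rewrite Ew E mul0r.
have [|//|e [w [cw Ew1]]] := IHk w1.
  have p1 : (1 < size p)%N := p_irr.1.
  move: sw; rewrite Ew size_mul //; move: (size _) (size _) p1 => x y. lia.
by exists e.+1, w; split=> //; rewrite Ew Ew1 exprS; ring.
Qed.

Lemma dvd_of_deriv_mod a : deriv_mod_regular p (a%:F / p%:F) -> p %| a.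
Proof.
have cancel w r : coprimep p w -> p %| r * w -> p %| r.
  by move=> cw; rewrite Gauss_dvdpl.
move=> [h [v [[m [z [cz ->]]]]]].
have z0 := coprime_neq0 cz.
elim/frac_ind: h => n w0 w00.
(* Only a pole of order at least [2] can come out of differentiating a pole. *)
have [e [w [cw ->]]] := multiplicity_factor w00.
have w0' := coprime_neq0 cw.
(* Induction on the exponent of [p] in the denominator of [h]. At exponent zero [h] is regular,
   hence so are its derivative and [a / p]. *)
elim: e n => [|e IHe] n E.
  have : a%:F / p%:F - m%:F / z%:F - (n^`() * w - n * w^`())%:F / (w ^+ 2)%:F == 0.
    by rewrite E mul1r frac_deriv_div // addrK subrr.
  rewrite subr_eq0 sub_frac // eq_frac ?mulf_neq0 ?expf_neq0 //.
  move=> /eqP Epoly.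
  apply: (cancel (z * w ^+ 2)); first by rewrite !coprimepMr cz cw.
  apply/dvdpP; exists (m * w ^+ 2 + (n^`() * w - n * w^`()) * z).
  by move: Epoly; rewrite mulrBl => /eqP; rewrite subr_eq => /eqP Ep;
    rewrite mulrA Ep; ring.
have W0 : p ^+ e.+1 * w != 0 by rewrite mulf_neq0 ?expf_neq0.
have [|ndvd] := boolP (p %| n).
  move=> /dvdpP[n1 En]; apply: (IHe n1); rewrite E En; congr (frac_deriv _ + _).
  apply/eqP; rewrite eq_frac // ?mulf_neq0 ?expf_neq0 //.
  by apply/eqP; rewrite exprS; ring.
case/negP: ndvd.
have : a%:F / p%:F - m%:F / z%:F
    - frac_deriv (n%:F / (p ^+ e.+1 * w)%:F) == 0 by rewrite E addrK subrr.
rewrite subr_eq0 sub_frac // frac_deriv_div // eq_frac ?mulf_neq0 ?expf_neq0 //.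
move=> /eqP Epoly.
(* Up to sign and the factor [z], the product of [n] with this cofactor is the leading term of the
   derivative, of pole order [e + 2]. All other terms have smaller order, so [p] divides the
   product; the cofactor is prime to [p]. *)
apply: (cancel (e.+1%:R * p^`() * w * z)).
  rewrite !coprimepMr cz cw coprimep_deriv !andbT.
  by rewrite -polyC_natr -alg_polyC coprimepZr ?coprimep1 ?natr_eq0.
apply/dvdpP.
(* The quotient is read off by clearing denominators in [Epoly] and dividing by the common powers of
   [p] and [w]. *)
exists (z * (n^`() * w - n * w^`()) - (a * z - m * p) * p ^+ e * w ^+ 2).
apply: (mulfI (x := p ^+ e * p)); first by rewrite mulf_neq0 ?expf_neq0.
have dW : (p ^+ e.+1 * w)^`() =
    p ^+ e * (e.+1%:R * p^`() * w + p * w^`()).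
  by rewrite derivM deriv_exp -mulr_natr exprS; ring.
move: Epoly; rewrite dW (exprS p e) => Epoly.
have : n * (e.+1%:R * p^`() * w * z) * (p ^+ e * p) =
  z * (n^`() * w - n * w^`()) * p ^+ e * p * p -
   (n^`() * (p * p ^+ e * w) - n * (p ^+ e * (e.+1%:R * p^`() * w + p * w^`()))) * (p * z).
  ring.
rewrite -Epoly => E2; rewrite mulrC E2; ring.
Qed.

(** A Bezout relation splits off the part of the denominator prime to [p]; integration by parts then
    lowers the exponent of [p] one step at a time until it is at most one. *)
Lemma Hermite_reduction_at u :
  exists a, deriv_mod_regular p (u - a%:F / p%:F).
Proof.
elim/frac_ind: u => n w0 w00.
have [e [w [cw ->]]] := multiplicity_factor w00.
have w0' := coprime_neq0 cw.
have /Bezout_eq1_coprimepP[[s t] /= st1] : coprimep (p ^+ e) w by rewrite coprimep_expl.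
have -> : n%:F / (p ^+ e * w)%:F = (n * s)%:F / w%:F + (n * t)%:F / (p ^+ e)%:F.
  apply/eqP; rewrite -subr_eq sub_frac ?mulf_neq0 ?expf_neq0 //.
  rewrite eq_frac ?mulf_neq0 ?expf_neq0 //; apply/eqP.
  transitivity (n * (s * p ^+ e) * p ^+ e * w); last by ring.
  by rewrite -[s * _](addrK (t * w)) st1; ring.
have rs : deriv_mod_regular p ((n * s)%:F / w%:F).
  by apply: regular_deriv_mod; exists (n * s), w.
suff [a Ha] : exists a, deriv_mod_regular p ((n * t)%:F / (p ^+ e)%:F - a%:F / p%:F).
  by exists a; rewrite -addrA; apply: deriv_mod_regularD.
move: (n * t) => {rs w00 w0 cw w0' st1 n s t w} n.
elim: e n => [|e IHe] n.
  exists 0; rewrite tofrac0 mul0r subr0; apply: regular_deriv_mod.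
  by exists n, (p ^+ 0); rewrite expr0 coprimep1.
case: e IHe => [|e] IHe.
  by exists n; rewrite subrr; apply/regular_deriv_mod/regular_at0.
have /Bezout_eq1_coprimepP[[s t] /= st1] := coprimep_deriv.
(* By [st1], [n] is [n * s * p] plus [n * t] times the derivative of [p]. The second summand over
   [p ^+ e.+2] is integrated by parts, which divides by [e.+1]. *)
pose C : {poly K} := (e.+1%:R^-1)%:P.
have C1 : C * e.+1%:R = 1 by rewrite -polyC_natr -polyCM mulVf // natr_eq0.
have [a Ha] := IHe (n * s + C * (n * t)^`()); exists a.
have -> : n%:F / (p ^+ e.+2)%:F = (n * s + C * (n * t)^`())%:F / (p ^+ e.+1)%:F
    - frac_deriv ((C * (n * t))%:F / (p ^+ e.+1)%:F).
  have pe i : p ^+ i != 0 by rewrite expf_neq0.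
  rewrite frac_deriv_div // sub_frac ?expf_neq0 //.
  apply/eqP; rewrite eq_frac //; last by rewrite mulf_neq0 // expf_neq0.
  apply/eqP.
  rewrite [in RHS]derivM derivC mul0r add0r.
  have -> : (p ^+ e.+1)^`() = e.+1%:R * p^`() * p ^+ e.
    by rewrite deriv_exp -mulr_natr /=; ring.
  have -> : (C * (n * t)) * (e.+1%:R * p^`() * p ^+ e) =
    (C * e.+1%:R) * (n * t * p ^+ e * p^`()) by ring.
  transitivity (n * (s * p + t * p^`()) * p ^+ e ^+ 3 * p ^+ 3).
    by rewrite st1 !(exprS p); ring.
  by rewrite C1 !(exprS p); ring.
by rewrite addrAC; apply: deriv_mod_regularB => //; apply: frac_deriv_mod.
Qed.

End Residue.

(** * Gauss's lemma *)

Section Gauss.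
Variable F : fieldType.
Implicit Types (c : {poly F}) (A B d e : {poly {poly F}}).

Lemma dvd_coefs c A : (forall i, c %| A`_i) -> exists A', A = c%:P * A'.
Proof.
move=> dvd; exists (map_poly (fun r => r %/ c) A); apply/polyP => i.
by rewrite coefCM coef_map_id0 ?div0p // mulrC divpK.
Qed.

(** If [i] and [j] are the least indices of coefficients of [A] and [B] not divisible by [c], the
    coefficient of index [i + j] of the product is [A_i * B_j] modulo [c]. *)
Lemma dvd_coefs_prime c A B : irreducible_poly c ->
  (forall i, c %| (A * B)`_i) ->
  (forall i, c %| A`_i) \/ (forall i, c %| B`_i).
Proof.
move=> c_irr dvdAB; apply: NNPP => /not_or_and[/not_all_ex_not exA /not_all_ex_not exB].
have {}exA : exists i, ~~ (c %| A`_i) by case: exA => i /negP; exists i.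
have {}exB : exists i, ~~ (c %| B`_i) by case: exB => i /negP; exists i.
case: (ex_minnP exA) => i ndA minA; case: (ex_minnP exB) => j ndB minB.
have := dvdAB (i + j)%N; rewrite coefM.
have li : (i < (i + j).+1)%N by rewrite ltnS leq_addr.
rewrite (bigD1 (Ordinal li)) //= addKn dvdp_addl.
  by rewrite -irreducible_poly_coprime // in ndA *; rewrite Gauss_dvdpr // (negPf ndB).
apply: (big_ind (fun r => c %| r)) => [|r r' | k ki]; first exact: dvdp0.
  exact: dvdp_add.
have [lt_ki|lt_ik|eq_ki] := ltngtP k i; last by rewrite -val_eqE /= eq_ki eqxx in ki.
- by apply: dvdp_mulr; apply: contraLR lt_ki => /minA; rewrite leqNgt.
- apply: dvdp_mull; have : (i + j - k < j)%N by have := ltn_ord k; lia.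
  by apply: contraLR => /minB; rewrite leqNgt.
Qed.

Lemma reducible_factor c : (1 < size c)%N -> ~ irreducible_poly c ->
  exists c1 c2, [/\ c = c1 * c2, (size c1 < size c)%N & (size c2 < size c)%N].
Proof.
move=> c_gt1 c_nirr; apply: NNPP => nex; apply: c_nirr; split=> // r r1 rc.
have c0 : c != 0 by rewrite -size_poly_gt0 ltnW.
have r0 : r != 0 by apply: contraTneq rc => ->; rewrite dvd0p.
have [r' Ec] := dvdpP _ _ rc.
have r'0 : r' != 0 by apply: contraNneq c0 => E; rewrite Ec E mul0r.
rewrite -dvdp_size_eqp // eqn_leq dvdp_leq //= leqNgt; apply/negP => lt_rc.
apply: nex; exists r', r; split=> //; rewrite Ec size_mul //.
have: (0 < size r)%N by rewrite size_poly_gt0.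
by move: r1; move: (size r) (size r') => x y; lia.
Qed.

(** Induction on the degree of [c]: a constant is absorbed into [A], an irreducible [c] divides one
    factor by [dvd_coefs_prime], and a reducible [c] is distributed in two rounds. *)
Lemma gauss_factor c d A B : c != 0 -> c%:P * d = A * B ->
  exists c1 c2 A' B', [/\ c = c1 * c2, A = c1%:P * A', B = c2%:P * B' & d = A' * B'].
Proof.
have [k] := ubnP (size c); elim: k c d A B => // k IHk c d A B size_c c0 E.
have cP0 : c%:P != 0 :> {poly {poly F}} by rewrite polyC_eq0.
have [c_le1|c_gt1] := leqP (size c) 1.
  have [r Ec] : exists r, c = r%:P by exists c`_0; apply: size1_polyC.
  have r0 : r != 0 by rewrite Ec polyC_eq0 in c0.
  exists c, 1, ((r^-1)%:P%:P * A), B.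
  have Kr : c%:P * (r^-1)%:P%:P = 1 :> {poly {poly F}}.
    by rewrite Ec -!polyCM mulfV.
  rewrite mulr1 mul1r mulrA Kr mul1r; split=> //.
  by apply: (mulfI cP0); rewrite E !mulrA Kr mul1r.
have [c_irr|c_red] := classic (irreducible_poly c).
  have [i|/dvd_coefs[A' EA]|/dvd_coefs[B' EB]] := dvd_coefs_prime (A := A) (B := B) c_irr.
  - by rewrite -E coefCM dvdp_mulr.
  - exists c, 1, A', B; rewrite !mulr1 mul1r; split=> //.
    by apply: (mulfI cP0); rewrite E EA mulrA.
  - exists 1, c, A, B'; rewrite !mul1r; split=> //.
    by apply: (mulfI cP0); rewrite E EB mulrCA.
have [c1 [c2 [Ec lt1 lt2]]] := reducible_factor c_gt1 c_red.
have /andP[c10 c20] : (c1 != 0) && (c2 != 0).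
  by rewrite -negb_or -mulf_eq0 -Ec.
have [||a1 [b1 [A1 [B1 [Ec1 EA EB E1]]]]] := IHk c1 (c2%:P * d) A B _ c10.
- exact: leq_trans lt1 _.
- by rewrite mulrA -polyCM -Ec.
have [||a2 [b2 [A2 [B2 [Ec2 EA1 EB1 E2]]]]] := IHk c2 d A1 B1 _ c20.
- exact: leq_trans lt2 _.
- by [].
exists (a1 * a2), (b1 * b2), A2, B2; split=> //.
- by rewrite Ec Ec1 Ec2 mulrACA.
- by rewrite EA EA1 mulrA -polyCM.
- by rewrite EB EB1 mulrA -polyCM.
Qed.

Lemma kxy_of_polyE d : kxy_of_poly d = map_poly (@FracField.tofrac {poly F}) d.
Proof. by []. Qed.

Lemma tofrac_inj (R : idomainType) : injective (@FracField.tofrac R).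
Proof. by move=> r r' /eqP; rewrite tofrac_eq => /eqP. Qed.

Lemma kxy_of_poly_inj : injective (@kxy_of_poly F).
Proof. exact: map_inj_poly (@tofrac_inj _) (tofrac0 _). Qed.

Lemma size_kxy_of_poly d : size (kxy_of_poly d) = size d.
Proof. by apply: size_map_inj_poly; [apply: tofrac_inj | apply: tofrac0]. Qed.

Lemma clear_denominators (Q : {poly (kx F)}) :
  exists c Q', c != 0 /\ (c%:F)%:P * Q = kxy_of_poly Q'.
Proof.
elim/poly_ind: Q => [|Q r [c [Q' [c0 E]]]].
  by exists 1, 0; rewrite oner_neq0 mulr0 kxy_of_polyE rmorph0.
elim/frac_ind: r => n m m0.
exists (c * m), (Q' * m%:P * 'X + (c * n)%:P); split; first exact: mulf_neq0.
rewrite mulrDr -polyCM; have -> : (c * m)%:F * (n%:F / m%:F) = (c * n)%:F.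
  by rewrite !tofracM -mulrA [m%:F * _]mulrC divfK ?tofrac_eq0.
rewrite kxy_of_polyE rmorphD !rmorphM /= map_polyX !map_polyC /=.
rewrite -kxy_of_polyE -E.
rewrite -!mulrA; congr (_ * _ + _); exact: mulrCA.
Qed.

Lemma unit_polyC2 (u : {poly {poly F}}) : u \is a GRing.unit ->
  exists2 r : F, r != 0 & u = r%:P%:P.
Proof.
rewrite poly_unitE => /andP[/eqP su]; rewrite poly_unitE => /andP[/eqP su0].
rewrite unitfE => r0; exists (u`_0)`_0 => //.
by rewrite -size1_polyC ?su0 // -size1_polyC ?su.
Qed.

(** Clearing denominators in a factorization over [k(x)] gives one of a multiple [c * d];
    [gauss_factor] removes [c] without changing the degrees in [y]. Positive degree in [y] excludes
    the [d] that become units. *)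
Lemma irreducible_kxy_of_poly d : irreducible_elt d -> (1 < size d)%N ->
  irreducible_poly (kxy_of_poly d).
Proof.
move=> [d0 [_ d_irr]] d_gt1; split=> [|Q Q1 /dvdpP[R E]].
  by rewrite size_kxy_of_poly.
have [c [Q' [c0 EQ]]] := clear_denominators Q.
have [b [R' [b0 ER]]] := clear_denominators R.
have D0 : kxy_of_poly d != 0 by rewrite -size_poly_gt0 size_kxy_of_poly ltnW.
have [|b' [c' [R2 [Q2 [Ecb ER2 EQ2 Ed]]]]] :=
  gauss_factor (c := b * c) (d := d) (A := R') (B := Q') (mulf_neq0 b0 c0).
  apply: kxy_of_poly_inj; rewrite !kxy_of_polyE !rmorphM /= !map_polyC /=.
  by rewrite -!kxy_of_polyE -EQ -ER E mulrACA.
have /andP[b'0 c'0] : (b' != 0) && (c' != 0).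
  by rewrite -negb_or -mulf_eq0 -Ecb mulf_neq0.
have sQ : size Q = size Q2.
  transitivity (size (kxy_of_poly Q')).
    by rewrite -EQ size_Cmul // tofrac_eq0.
  by rewrite size_kxy_of_poly EQ2 size_Cmul.
have sR : size R = size R2.
  transitivity (size (kxy_of_poly R')).
    by rewrite -ER size_Cmul // tofrac_eq0.
  by rewrite size_kxy_of_poly ER2 size_Cmul.
have [uR|uQ] := d_irr _ _ Ed; last first.
  by move: uQ Q1; rewrite poly_unitE sQ => /andP[->].
have : size R == 1%N by move: uR; rewrite poly_unitE sR => /andP[].
move=> /eqP R1; have RC : R = (R`_0)%:P by apply: size1_polyC; rewrite R1.
have R0 : R`_0 != 0 by rewrite -polyC_eq0 -RC -size_poly_eq0 R1.
by rewrite E RC mul_polyC eqp_sym eqp_scale.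
Qed.

(** After denominators are cleared and distributed, [e] is a polynomial times a part of [d].
    Irreducibility of [e] and of [d], with positive degree in [y], makes both cofactors constants of
    [k]. *)
Lemma irreducible_dvd_associate d e :
  irreducible_elt d -> irreducible_elt e -> (1 < size d)%N ->
  kxy_of_poly d %| kxy_of_poly e ->
  exists2 r : F, r != 0 & e = r%:P%:P * d.
Proof.
move=> [d0 [_ d_irr]] [_ [_ e_irr]] d_gt1 /dvdpP[Q E].
have [c [Q' [c0 EQ]]] := clear_denominators Q.
have [|c1 [c2 [Q2 [d2 [Ec EQ' Ed Ee]]]]] :=
  gauss_factor (c := c) (d := e) (A := Q') (B := d) c0.
  apply: kxy_of_poly_inj; rewrite !kxy_of_polyE !rmorphM /= !map_polyC /=.
  by rewrite -!kxy_of_polyE -EQ E mulrA.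
have /andP[c10 c20] : (c1 != 0) && (c2 != 0) by rewrite -negb_or -mulf_eq0 -Ec.
have [uQ|ud] := e_irr _ _ Ee; last first.
  by move: d_gt1; rewrite Ed size_Cmul //; move: ud; rewrite poly_unitE => /andP[/eqP->].
have [uc|ud] := d_irr _ _ Ed; last first.
  by move: d_gt1; rewrite Ed size_Cmul //; move: ud; rewrite poly_unitE => /andP[/eqP->].
have [r r0 Er] := unit_polyC2 uQ; have [t t0 /polyC_inj Et] := unit_polyC2 uc.
exists (r / t); first by rewrite mulf_neq0 ?invr_eq0.
by rewrite Ee Ed Er Et mulrA -!polyCM -mulrA mulVf ?mulr1.
Qed.

End Gauss.

(** * Orbits of the shift and of the q-shift *)

Section Orbits.
Variables (F : fieldType) (s : shift_kind) (q : F).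
Hypothesis charF0 : [pchar F] =i pred0.
Hypothesis q_neq0 : q != 0.
Hypothesis q_not_root : forall n : nat, (0 < n)%N -> q ^+ n != 1.
Implicit Types (n m : int) (r : {poly F}) (d e : {poly {poly F}}).

Fact phi_pow_x_is_zmod_morphism n : zmod_morphism (phi_pow_x s q n).
Proof. by move=> r r'; rewrite /phi_pow_x; case: s; rewrite raddfB. Qed.

Fact phi_pow_x_is_monoid_morphism n : monoid_morphism (phi_pow_x s q n).
Proof.
by split=> [|r r']; rewrite /phi_pow_x; case: s; rewrite (rmorph1, rmorphM).
Qed.

HB.instance Definition _ n := GRing.isZmodMorphism.Build _ _ (phi_pow_x s q n)
  (phi_pow_x_is_zmod_morphism n).
HB.instance Definition _ n := GRing.isMonoidMorphism.Build _ _
  (phi_pow_x s q n) (phi_pow_x_is_monoid_morphism n).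

Lemma phi_pow_xD n m r : phi_pow_x s q n (phi_pow_x s q m r) = phi_pow_x s q (n + m) r.
Proof.
rewrite /phi_pow_x; case: s; rewrite -comp_polyA; congr (_ \Po _).
  by rewrite comp_polyD comp_polyX comp_polyC rmorphD polyCD addrA.
by rewrite comp_polyZ comp_polyX scalerA expfzDr // mulrC.
Qed.

Lemma phi_pow_x0 r : phi_pow_x s q 0 r = r.
Proof.
by rewrite /phi_pow_x; case: s; rewrite ?expr0z ?scale1r ?addr0 comp_polyXr.
Qed.

Lemma phi_pow_x_inj n : injective (phi_pow_x s q n).
Proof.
by move=> r r' /(congr1 (phi_pow_x s q (- n))); rewrite !phi_pow_xD addNr !phi_pow_x0.
Qed.

Lemma phi_pow_xC n (c : F) : phi_pow_x s q n c%:P = c%:P.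
Proof. by rewrite /phi_pow_x; case: s; rewrite comp_polyC. Qed.

Lemma phi_pow_xyE n d : phi_pow_xy s q n d = map_poly (phi_pow_x s q n) d.
Proof. by []. Qed.

Lemma coef_phi_pow_xy n d i : (phi_pow_xy s q n d)`_i = phi_pow_x s q n d`_i.
Proof. exact: coef_map. Qed.

Lemma phi_pow_xyD n m d :
  phi_pow_xy s q n (phi_pow_xy s q m d) = phi_pow_xy s q (n + m) d.
Proof. by apply/polyP => i; rewrite !coef_phi_pow_xy phi_pow_xD. Qed.

Lemma phi_pow_xy0 d : phi_pow_xy s q 0 d = d.
Proof. by apply/polyP => i; rewrite coef_phi_pow_xy phi_pow_x0. Qed.

Lemma size_phi_pow_xy n d : size (phi_pow_xy s q n d) = size d.
Proof. by apply: size_map_inj_poly; [apply: phi_pow_x_inj | apply: rmorph0]. Qed.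

Lemma phi_pow_xy_in_ky n d : in_ky d -> phi_pow_xy s q n d = d.
Proof.
move=> dky; apply/polyP => i; rewrite coef_phi_pow_xy.
by rewrite (size1_polyC (dky i)) phi_pow_xC.
Qed.

Lemma irreducible_phi_pow_xy n d :
  irreducible_elt d -> irreducible_elt (phi_pow_xy s q n d).
Proof.
have unit_phi k e : e \is a GRing.unit -> phi_pow_xy s q k e \is a GRing.unit.
  by rewrite phi_pow_xyE; apply: rmorph_unit.
have unit_phiV k e : phi_pow_xy s q k e \is a GRing.unit -> e \is a GRing.unit.
  by move=> /(unit_phi (- k)); rewrite phi_pow_xyD addNr phi_pow_xy0.
move=> [d0 [dnu d_irr]]; split.
  by rewrite -size_poly_eq0 size_phi_pow_xy size_poly_eq0.
split; first by apply: contra dnu => /unit_phiV.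
move=> a b /(congr1 (phi_pow_xy s q (- n))).
rewrite phi_pow_xyD addNr phi_pow_xy0 {1}phi_pow_xyE rmorphM => /d_irr.
by case=> /unit_phiV; [left | right].
Qed.

Lemma natrF_eq0 (i : nat) : (i%:R == 0 :> F) = (i == 0%N).
Proof. by move/pcharf0P: charF0 => ->. Qed.

(** Leading coefficients give [c = 1], so [r] takes the value [r.[0]] at all multiples of [h], which
    are distinct in characteristic zero; a nonconstant [r] cannot do so. *)
Lemma shift_semi_invariant (h c : F) r : h != 0 ->
  r \Po ('X + h%:P) = c%:P * r -> (size r <= 1)%N.
Proof.
move=> h0 E; have [->|r0] := eqVneq r 0; first by rewrite size_poly0.
have c1 : c = 1.
  apply: (mulIf (x := lead_coef r)); first by rewrite lead_coef_eq0.
  rewrite mul1r -[c in LHS]lead_coefC -lead_coefM -E lead_coef_comp ?size_XaddC //.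
  by rewrite lead_coefXaddC expr1n mulr1.
have Er : r \Po ('X + h%:P) = r by rewrite E c1 mul1r.
have per (i : nat) : r.[i%:R * h] = r.[0].
  elim: i => [|i IHi]; first by rewrite mul0r.
  rewrite -IHi -[in RHS]Er horner_comp hornerD hornerX hornerC.
  by rewrite -natr1 mulrDl mul1r.
rewrite leqNgt; apply/negP => r_gt1.
have t0 : r - r.[0]%:P != 0.
  by rewrite subr_eq0; apply: contraTneq r_gt1 => ->; rewrite -leqNgt size_polyC_leq1.
have /= := max_poly_roots t0 (rs := [seq i%:R * h | i <- iota 0 (size r)]).
rewrite size_map size_iota => lt.
suff : (size r < size (r - r.[0]%:P)%R)%N.
  rewrite ltnNge; apply/negP/negPn; apply: (leq_trans (size_polyD _ _)).
  by rewrite size_polyN geq_max leqnn (leq_trans (size_polyC_leq1 _)) // ltnW.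
apply: lt.
  by apply/allP => _ /mapP[i _ ->]; rewrite /root !hornerE per subrr.
rewrite map_inj_uniq ?iota_uniq // => i j /(mulIf h0) /eqP.
wlog le_ij : i j / (i <= j)%N.
  move=> W; case/orP: (leq_total i j) => H E2; first exact: W.
  by apply/esym/W; rewrite // eq_sym.
rewrite eq_sym -subr_eq0 -natrB // natrF_eq0 subn_eq0 => le_ji.
by apply/eqP; rewrite eqn_leq le_ij.
Qed.

Lemma coef_comp_scaleX (z : F) r i : (r \Po (z *: 'X))`_i = z ^+ i * r`_i.
Proof.
rewrite comp_polyE.
under eq_bigr do rewrite exprZn scalerA.
rewrite -(poly_def _ (fun i => r`_i * z ^+ i)) coef_poly.
by case: ltnP => [_|le]; [rewrite mulrC | rewrite nth_default ?mulr0].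
Qed.

Lemma exprz_not_root n (k : nat) : n != 0 -> (0 < k)%N -> (q ^ n) ^+ k != 1.
Proof.
case: n => n n0 k0; first by rewrite -exprnP -exprM q_not_root // muln_gt0 lt0n n0.
by rewrite NegzE -exprnN exprVn -exprM invr_eq1 q_not_root // muln_gt0.
Qed.

(** The shift case is settled coefficient by coefficient. In the q-shift case a coefficient of
    positive degree in [x] forces [c != 1]; then all coefficients vanish at [x = 0], so [x] divides
    [d], against irreducibility and positive degree in [y]. *)
Lemma semi_invariant_in_ky n (c : F) d : n != 0 -> irreducible_elt d ->
  (1 < size d)%N -> phi_pow_xy s q n d = c%:P%:P * d -> in_ky d.
Proof.
move=> n0 [_ [_ d_irr]] d_gt1 E j.
have {}E i : phi_pow_x s q n d`_i = c%:P * d`_i by rewrite -coef_phi_pow_xy E coefCM.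
move: E; rewrite /phi_pow_x; case: s => E.
  apply: (@shift_semi_invariant n%:~R c) => //.
  by case: (n) n0 => k k0; rewrite ?NegzE ?mulrNz ?oppr_eq0 -pmulrn natrF_eq0.
rewrite leqNgt; apply/negP => dj_gt1.
have dj0 : d`_j != 0 by rewrite -size_poly_gt0 ltnW.
have Ec : c = (q ^ n) ^+ (size d`_j).-1.
  apply: (mulIf (x := lead_coef d`_j)); first by rewrite lead_coef_eq0.
  by rewrite lead_coefE -coef_comp_scaleX E coefCM.
have c1 : c != 1 by rewrite Ec exprz_not_root // -ltnS prednK // ltnW.
have [i|e Ed] := @dvd_coefs F 'X d.
  rewrite -['X]subr0 -polyC0 dvdp_XsubCl /root horner_coef0.
  have := congr1 (fun r : {poly F} => r`_0) (E i).
  rewrite coef_comp_scaleX coefCM expr0 mul1r => /eqP.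
  by rewrite -subr_eq0 -[X in X - _]mul1r -mulrBl mulf_eq0 subr_eq0 eq_sym (negPf c1).
have [] := d_irr _ _ Ed; rewrite poly_unitE => /andP[].
  by rewrite coefC /= poly_unitE size_polyX.
by move=> /eqP e1; move: d_gt1; rewrite Ed size_Cmul ?polyX_eq0 // e1.
Qed.

End Orbits.

(** Dividing [w] by some [P i] lowers its degree and, by coprimality, does not affect the other
    indices, so only finitely many are exceptional. *)
Lemma coprimep_almost_all (K : fieldType) (I : eqType) (P : I -> {poly K}) w :
  (forall i, irreducible_poly (P i)) ->
  (forall i j, i != j -> coprimep (P i) (P j)) -> w != 0 ->
  exists t : seq I, forall i, i \notin t -> coprimep (P i) w.
Proof.
move=> P_irr P_coprime; have [k] := ubnP (size w).
elim: k w => // k IHk w size_w w0.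
have [[i dvd]|nex] := classic (exists i, P i %| w); last first.
  exists [::] => i _; rewrite irreducible_poly_coprime //.
  by apply/negP => dvd; apply: nex; exists i.
have [w' Ew] := dvdpP _ _ dvd.
have w'0 : w' != 0 by apply: contraNneq w0 => E; rewrite Ew E mul0r.
have size_w' : (size w' < k)%N.
  have i_gt1 : (1 < size (P i))%N := (P_irr i).1.
  move: size_w; rewrite Ew size_mul //; last exact: irredp_neq0 (P_irr i).
  by move: (size _) (size _) i_gt1 => x y; lia.
have [t Ht] := IHk w' size_w' w'0.
exists (i :: t) => j; rewrite inE negb_or => /andP[ji jt].
by rewrite Ew coprimepMr Ht // P_coprime.
Qed.

(** * Extension to rational functions *)

Section Extension.
Variables (F : fieldType) (s : shift_kind) (q : F) (q_neq0 : q != 0).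
Hypothesis charF0 : [pchar F] =i pred0.
Implicit Types (n m : int) (d e : {poly {poly F}}).

Definition phi_pow_kx n := frac_map (@phi_pow_x_inj F s q q_neq0 n).

HB.instance Definition _ n := GRing.RMorphism.on (phi_pow_kx n).

Lemma phi_pow_kxy_poly_inj n : injective (map_poly (phi_pow_kx n)).
Proof. exact: map_poly_inj. Qed.

(** All integer powers of [phi] on [k(x,y)]; exponent [1] unfolds to [phi_kxy]. *)
Definition phi_pow_kxy n := frac_map (@phi_pow_kxy_poly_inj n).

HB.instance Definition _ n := GRing.RMorphism.on (phi_pow_kxy n).

Lemma phi_pow_x_neq0 n (c : {poly F}) : c != 0 -> phi_pow_x s q n c != 0.
Proof. by rewrite -(inj_eq (@phi_pow_x_inj F s q q_neq0 n)) rmorph0. Qed.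

Lemma phi_pow_kxD n m u : phi_pow_kx n (phi_pow_kx m u) = phi_pow_kx (n + m) u.
Proof.
elim/frac_ind: u => a b b0.
by rewrite /phi_pow_kx !frac_map_div ?phi_pow_x_neq0 //= !phi_pow_xD.
Qed.

Lemma phi_pow_kx0 u : phi_pow_kx 0 u = u.
Proof.
by elim/frac_ind: u => a b b0; rewrite /phi_pow_kx frac_map_div //= !phi_pow_x0.
Qed.

Lemma phi_pow_kxyD n m u :
  phi_pow_kxy n (phi_pow_kxy m u) = phi_pow_kxy (n + m) u.
Proof.
elim/frac_ind: u => a b b0.
rewrite /phi_pow_kxy !frac_map_div ?map_poly_eq0 //.
congr (_%:F / _%:F); apply/polyP => i; rewrite !coef_map; exact: phi_pow_kxD.
Qed.

Lemma phi_pow_kxy0 u : phi_pow_kxy 0 u = u.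
Proof.
elim/frac_ind: u => a b b0; rewrite /phi_pow_kxy frac_map_div //.
congr (_%:F / _%:F); apply/polyP => i; rewrite !coef_map; exact: phi_pow_kx0.
Qed.

Lemma phi_pow_kxy_of_poly n d :
  map_poly (phi_pow_kx n) (kxy_of_poly d) = kxy_of_poly (phi_pow_xy s q n d).
Proof.
apply/polyP => i; rewrite !kxy_of_polyE !coef_map.
by rewrite /= /phi_pow_kx frac_map_tofrac.
Qed.

Lemma phi_pow_kxy_div n (a b : {poly (kx F)}) : b != 0 ->
  phi_pow_kxy n (a%:F / b%:F) =
    (map_poly (phi_pow_kx n) a)%:F / (map_poly (phi_pow_kx n) b)%:F.
Proof. exact: frac_map_div. Qed.

Lemma phi_pow_kxy_deriv n u :
  phi_pow_kxy n (frac_deriv u) = frac_deriv (phi_pow_kxy n u).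
Proof. exact: frac_deriv_map. Qed.

Lemma charKx0 : [pchar (kx F)] =i pred0.
Proof.
apply/pcharf0P => n; rewrite -(rmorph_nat (@FracField.tofrac {poly F})).
by rewrite tofrac_eq0 -polyC_natr polyC_eq0 (natrF_eq0 charF0).
Qed.

Lemma coprimep_phi_pow_xy d e n : irreducible_elt d -> irreducible_elt e ->
  (1 < size d)%N ->
  (forall c : F, c != 0 -> phi_pow_xy s q n e <> c%:P%:P * d) ->
  coprimep (kxy_of_poly d) (kxy_of_poly (phi_pow_xy s q n e)).
Proof.
move=> d_irr e_irr d_gt1 nassoc.
rewrite irreducible_poly_coprime; last exact: irreducible_kxy_of_poly.
apply/negP => dvd; have e'_irr := irreducible_phi_pow_xy s q_neq0 n e_irr.
have [c c0 E] := irreducible_dvd_associate d_irr e'_irr d_gt1 dvd.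
exact: nassoc E.
Qed.

(** A power of [phi] that fixes [p] preserves coprimality with [p], and it commutes with the
    derivation. *)
Lemma deriv_mod_regular_phi (p : {poly (kx F)}) n u :
  irreducible_poly p -> map_poly (phi_pow_kx n) p = p ->
  deriv_mod_regular p u -> deriv_mod_regular p (phi_pow_kxy n u).
Proof.
move=> p_irr fixp [h [_ [[a [w [cw ->]]] ->]]].
exists (phi_pow_kxy n h), (phi_pow_kxy n (a%:F / w%:F)); split.
  exists (map_poly (phi_pow_kx n) a), (map_poly (phi_pow_kx n) w).
  rewrite -{1}fixp coprimep_map cw phi_pow_kxy_div //.
  apply: contraTneq cw => ->; rewrite coprimep0 -size_poly_eq1.
  by rewrite gtn_eqF // p_irr.1.
by rewrite rmorphD /= phi_pow_kxy_deriv.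
Qed.

End Extension.

(** * Necessity of the conditions *)

Section Necessity.
Variables (F : fieldType) (s : shift_kind) (q : F) (q_neq0 : q != 0).
Hypothesis charF0 : [pchar F] =i pred0.
Hypothesis q_not_root : forall n : nat, (0 < n)%N -> q ^+ n != 1.
Variables (m : nat) (a : 'I_m -> {poly (kx F)}) (d : 'I_m -> {poly {poly F}}).
Hypothesis a_neq0 : forall i, a i != 0.
Hypothesis d_irr : forall i, irreducible_elt (d i).
Hypothesis deg_ad : forall i, (size (a i) < size (d i))%N.
Hypothesis d_orbits : forall i j, i != j -> ~ same_phi_orbit s q (d i) (d j).
Variables G H : kxy F.

Let phi := phi_pow_kxy s q_neq0.
Let p i := kxy_of_poly (d i).
Let r : kxy F := \sum_(i < m) (a i)%:F / (p i)%:F.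

Hypothesis r_exact : r = phi 1 G - G + frac_deriv H.

Let d_gt1 i : (1 < size (d i))%N.
Proof. by apply: leq_ltn_trans (deg_ad i); rewrite size_poly_gt0. Qed.

Let p_irr i : irreducible_poly (p i).
Proof. exact: irreducible_kxy_of_poly. Qed.

Let p_neq0 i : p i != 0.
Proof. exact: irredp_neq0 (p_irr i). Qed.

Let charK0 := charKx0 charF0.

(** An association would either put two of the [d] in one orbit or make [d i] semi-invariant under a
    nonzero power, hence free of [x]. *)
Let coprime_orbit i j n : i != j \/ n != 0 /\ ~ in_ky (d i) ->
  coprimep (p i) (kxy_of_poly (phi_pow_xy s q n (d j))).
Proof.
move=> ij; apply: coprimep_phi_pow_xy => // c c0 E.
have [eq_ij|neq_ij] := eqVneq i j.
  case: ij => [/eqP//|[n0]]; apply; subst j.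
  exact: semi_invariant_in_ky E.
by apply: (@d_orbits j i); [rewrite eq_sym | exists n, c].
Qed.

Let regular_term i j n : i != j \/ n != 0 /\ ~ in_ky (d i) ->
  regular_at (p i) (phi n ((a j)%:F / (p j)%:F)).
Proof.
move=> ij; rewrite /phi phi_pow_kxy_div // phi_pow_kxy_of_poly.
by eexists; eexists; split; first exact: coprime_orbit ij.
Qed.

Let regular_rest i : regular_at (p i) (r - (a i)%:F / (p i)%:F).
Proof.
rewrite /r (bigD1 i) //= addrC addrK.
apply: (big_ind (regular_at (p i))) => [|u v|j ij].
- exact: regular_at0.
- exact: regular_atD.
rewrite -[X in regular_at _ X](phi_pow_kxy0 s q_neq0).
by apply: regular_term; left; rewrite eq_sym.
Qed.

Let size_p i : size (p i) = size (d i).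
Proof. exact: size_kxy_of_poly. Qed.

(* Modulo terms with zero residue at [p i], the sequence [phi n G] is constant
   for [n >= 1] and for [n <= 0], and it vanishes for large [|n|] because the
   polynomials [phi (- n) (p i)] are pairwise coprime. *)
Lemma denominator_in_ky i : in_ky (d i).
Proof.
apply: NNPP => nky.
pose S n := deriv_mod_regular (p i) (phi n G).
(* Applying [phi n] to [r_exact]: for [n != 0] every denominator of [phi n r] is prime to [p i].
   Only [n = 0] lets the pole [a i / p i] through. *)
have step n : n != 0 -> deriv_mod_regular (p i) (phi (n + 1) G - phi n G).
  move=> n0; have -> : phi (n + 1) G - phi n G = phi n r - frac_deriv (phi n H).
    rewrite r_exact [phi n (_ + _)]rmorphD rmorphB.
    by rewrite /phi /= phi_pow_kxyD phi_pow_kxy_deriv addrK.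
  apply: (deriv_mod_regularB (p_irr i)); last exact: frac_deriv_mod.
  apply: regular_deriv_mod; rewrite /r /phi rmorph_sum /=.
  apply: (big_ind (regular_at (p i))) => [|u v|j _].
  - exact: regular_at0.
  - exact: regular_atD.
  - by apply: regular_term; right.
have stepD n : n != 0 -> S (n + 1) -> S n.
  move=> n0 Sn; have := deriv_mod_regularB (p_irr i) Sn (step n n0).
  by rewrite opprB addrC subrK.
have stepU n : n != 0 -> S n -> S (n + 1).
  move=> n0 Sn; have := deriv_mod_regularD (p_irr i) Sn (step n n0).
  by rewrite addrC subrK.
(* [phi n G] is regular at [p i] as soon as the denominator of [G] is prime to [phi (- n) (p i)],
   which fails for finitely many [n]. *)
have [t Ht] : exists t : seq int, forall n, n \notin t -> S n.
  elim/frac_ind: (G) => N W W0 in S step stepD stepU *.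
  have P_irr n : irreducible_poly (kxy_of_poly (phi_pow_xy s q (- n) (d i))).
    apply: irreducible_kxy_of_poly; first exact: irreducible_phi_pow_xy.
    by rewrite size_phi_pow_xy.
  have P_coprime n k : n != k ->
      coprimep (kxy_of_poly (phi_pow_xy s q (- n) (d i)))
               (kxy_of_poly (phi_pow_xy s q (- k) (d i))).
    move=> nk; rewrite -(coprimep_map (phi_pow_kx s q_neq0 n)).
    rewrite !phi_pow_kxy_of_poly !phi_pow_xyD // subrr phi_pow_xy0.
    by apply: coprime_orbit; right; rewrite subr_eq0.
  have [t Ht] := coprimep_almost_all P_irr P_coprime W0.
  exists t => n /Ht; rewrite -(coprimep_map (phi_pow_kx s q_neq0 n)).
  rewrite phi_pow_kxy_of_poly phi_pow_xyD // subrr phi_pow_xy0 => cW.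
  apply: regular_deriv_mod; rewrite /phi phi_pow_kxy_div //.
  by eexists; eexists; split; first exact: cW.
have [M HM] : exists M : nat, forall n, (M < `|n|)%N -> S n.
  suff [M HM] : exists M : nat, forall n, n \in t -> (`|n| <= M)%N.
    by exists M => n lt; apply: Ht; apply: contraL lt => /HM; rewrite -leqNgt.
  elim: (t) => [|n t' [M HM]]; first by exists 0%N.
  exists (maxn `|n| M) => k; rewrite inE leq_max => /predU1P[->|/HM->].
    by rewrite leqnn.
  by rewrite orbT.
have S1 : S 1.
  have : S (M.+1)%:Z by apply: HM.
  elim: (M) => // k IHk Sk; apply: IHk; apply: stepD => //.
  by have -> : k.+1%:Z + 1 = k.+2%:Z by lia.
have S0 : S 0.
  have : S (- (M.+1)%:Z) by apply: HM; rewrite abszN.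
  elim: (M.+1) => [|k IHk]; first by rewrite oppr0.
  move=> Sk; apply: IHk.
  have -> : - k%:Z = - (k.+1)%:Z + 1 by lia.
  exact: stepU.
(* The relation at [n = 0] now shows that the surviving term has zero residue, so [p i] divides
   [a i], against the degrees. *)
have : deriv_mod_regular (p i) ((a i)%:F / (p i)%:F).
  have -> : (a i)%:F / (p i)%:F =
    phi 1 G - phi 0 G + frac_deriv H - (r - (a i)%:F / (p i)%:F).
    by rewrite [phi 0 G]phi_pow_kxy0 -r_exact opprB addrC subrK.
  apply: (deriv_mod_regularB (p_irr i)); last exact: regular_deriv_mod.
  apply: (deriv_mod_regularD (p_irr i)); last exact: frac_deriv_mod.
  exact: (deriv_mod_regularB (p_irr i)).
move=> /(dvd_of_deriv_mod charK0 (p_irr i)) /(dvdp_leq (a_neq0 i)).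
by rewrite leqNgt size_p deg_ad.
Qed.

(** As [phi] fixes [p i], it carries a Hermite remainder [c] of [G] to the remainder [psi c] of
    [phi 1 G]. Comparing residues gives [a i] congruent to [psi c - c] modulo [p i]. *)
Lemma numerator_summable i :
  exists b : {poly (kx F)}, a i = map_poly (phi_pow_kx s q_neq0 1) b - b.
Proof.
have fixp : map_poly (phi_pow_kx s q_neq0 1) (p i) = p i.
  by rewrite phi_pow_kxy_of_poly phi_pow_xy_in_ky //; apply: denominator_in_ky.
have [c Hc] := Hermite_reduction_at charK0 (p_irr i) G.
set psi := map_poly (phi_pow_kx s q_neq0 1) in fixp *.
have Hphi := deriv_mod_regular_phi (p_irr i) fixp Hc.
rewrite rmorphB /= phi_pow_kxy_div // -/psi fixp in Hphi.
have : p i %| a i - (psi c - c).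
  apply: (dvd_of_deriv_mod charK0 (p_irr i)).
  have -> : (a i - (psi c - c))%:F / (p i)%:F =
     (phi 1 G - (psi c)%:F / (p i)%:F) - (G - c%:F / (p i)%:F) + frac_deriv H
     - (r - (a i)%:F / (p i)%:F).
    rewrite r_exact !rmorphB /= !mulrBl.
    move: (phi 1 G) G (frac_deriv H) (_ / _) (_ / _) (_ / _) => x1 x2 x3 x4 x5 x6.
    ring.
  apply: (deriv_mod_regularB (p_irr i)); last exact: regular_deriv_mod.
  apply: (deriv_mod_regularD (p_irr i)); last exact: frac_deriv_mod.
  exact: (deriv_mod_regularB (p_irr i)).
(* Reduction modulo [p i] commutes with [psi], and [a i] is already reduced, so the congruence
   becomes an equality. *)
move=> /modp_eq0P dvd; exists (c %% p i); apply/eqP; rewrite -subr_eq0.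
rewrite {1}/psi map_modp -/psi fixp -[in X in X == _](modp_small (p := a i) (q := p i)) ?size_p //.
by move: dvd; rewrite modpD modpN modpD modpN => ->.
Qed.

End Necessity.

(** * Reduction to the fraction part, and sufficiency of the conditions *)

Theorem theorem2 (F : fieldType) (charF0 : [pchar F] =i pred0)
  (q : F) (q_neq0 : q != 0) (q_not_root : forall n : nat, (0 < n)%N -> q ^+ n != 1)
  (s : shift_kind) (f g h : kxy F) (m : nat)
  (a : 'I_m -> {poly (kx F)}) (d : 'I_m -> {poly {poly F}})
  (a_neq0 : forall i, a i != 0)
  (d_irr : forall i, irreducible_elt (d i))
  (deg_ad : forall i, (size (a i) < size (d i))%N)
  (d_orbits : forall i j, i != j -> ~ same_phi_orbit s q (d i) (d j))
  (hf : f = phi_kxy s q g - g + Dy h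
            + \sum_(i < m) kxy_of_kxpoly (a i) / kxy_of_kxpoly (kxy_of_poly (d i))) :
  exact_phi_Dy s q f <->
  (forall i, in_ky (d i) /\ exists b : {poly (kx F)}, a i = phi_kxy_poly s q b - b).
Proof.
have phiE u : phi_kxy s q u = phi_pow_kxy s q_neq0 1 u by [].
have DyE u : Dy u = frac_deriv u by [].
split=> [[g' [h' Ef]] i|summable].
  (* Subtracting the given decomposition from a certificate of exactness leaves a certificate for
     the fraction part alone. *)
  have r_exact : \sum_(i < m) (a i)%:F / (kxy_of_poly (d i))%:F =
      phi_pow_kxy s q_neq0 1 (g' - g) - (g' - g) + frac_deriv (h' - h).
    rewrite rmorphB (raddfB (@frac_deriv _)) /= -!phiE -!DyE.
    have := Ef; rewrite hf /kxy_of_kxpoly.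
    move: (\sum_(_ < _) _) (phi_kxy s q g) (phi_kxy s q g') (Dy h) (Dy h').
    move=> x1 x2 x3 x4 x5 E.
    have -> : x1 = (x2 - g + x4 + x1) - (x2 - g + x4) by ring.
    by rewrite E; ring.
  split; first exact: denominator_in_ky r_exact i.
  exact: numerator_summable r_exact i.
have [g' Eg'] : exists g' : kxy F,
    \sum_(i < m) kxy_of_kxpoly (a i) / kxy_of_kxpoly (kxy_of_poly (d i)) =
    phi_kxy s q g' - g'.
  apply: (big_ind (fun u => exists g' : kxy F, u = phi_kxy s q g' - g')).
  - by exists 0; rewrite phiE rmorph0 subrr.
  - move=> _ _ [u ->] [v ->]; exists (u + v).
    by rewrite !phiE rmorphD opprD addrACA.
  move=> i _; have [dky [b Eb]] := summable i.
  (* [phi] fixes [d i], so dividing [b] by it turns the summation of [a i] into that of the whole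
     fraction. *)
  exists (b%:F / (kxy_of_poly (d i))%:F); rewrite phiE phi_pow_kxy_div.
    rewrite phi_pow_kxy_of_poly phi_pow_xy_in_ky // -mulrBl -tofracB.
    by rewrite /kxy_of_kxpoly Eb.
  by rewrite -size_poly_gt0 size_kxy_of_poly; apply: leq_ltn_trans (deg_ad i).
exists (g + g'), h; rewrite hf Eg' !phiE rmorphD /=.
move: (phi_pow_kxy _ _ _ g) (phi_pow_kxy _ _ _ g') (Dy h) => x1 x2 x3.
ring.
Qed.
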